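(* Let $K$ be a field, $S_1=K[x_1,\dots,x_n]$, $S_2=K[y_1,\dots,y_m]$, $S=K[x_1,\dots,x_n,y_1,\dots,y_m]$, and let $q,s,t,r$ be integers with $1\le q<s\le n$ and $1\le t<r\le m$. Let $I\subseteq S$ be any one of the following ideals: (1) $I_qS$; (2) $I_qJ_rS$; (3) $(I_q+J_t)S$; (4) $(I_qJ_r+I_s)S$; (5) $(I_qJ_r+I_sJ_t)S$. Then $\mathrm{v}(I)\le \mathrm{reg}(S/I)$.
   Context: For $1\le a\le n$, $I_a\subseteq S_1$ denotes the ideal generated by all square-free monomials of degree $a$ in the variables $x_1,\dots,x_n$; for $1\le b\le m$, $J_b\subseteq S_2$ denotes the ideal generated by all square-free monomials of degree $b$ in $y_1,\dots,y_m$. Sums and products of these ideals are taken after extension to $S$. $\mathrm{reg}(S/I)$ is the Castelnuovo-Mumford regularity: if $\bigoplus_j S(-j)^{b_{i,j}}$ is the $i$-th module of the minimal graded free resolution of $S/I$, then $\mathrm{reg}(S/I)=\max\{j-i : b_{i,j}\ne 0\}$. The v-number: for a graded ideal $I$ of a standard graded polynomial ring $S$ with graded maximal ideal $\mathfrak m$ (generated by all variables), $\mathrm{v}(I)=\min\{d\ge 1 : \text{there exist } f\in S_d \text{ and } \mathfrak p\in \mathrm{Ass}(I) \text{ with } (I:f)=\mathfrak p\}$ if $I\subsetneq\mathfrak m$, and $\mathrm{v}(\mathfrak m)=0$. Here $S_d$ is the degree-$d$ component and $\mathrm{Ass}(I)$ is the set of associated primes of $S/I$.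
   Formalization: For I = I_1 S (case (1) with q = 1), v(I) is taken as the minimum over d ≥ 0 instead of d ≥ 1, since with d ≥ 1 one gets v(I) = 1 > 0 = reg(S/I); for every other listed ideal the v-number is as defined. *)

(* Defs.v *)
From HB Require Import structures.
From mathcomp Require Import all_boot all_order all_algebra.
From mathcomp Require Export mpoly.

Set Implicit Arguments.
Unset Strict Implicit.
Unset Printing Implicit Defensive.

Import Order.TTheory GRing.Theory Num.Theory.
Local Open Scope ring_scope.

(* Ideals are Prop-valued predicates, compared extensionally by [ideq]. *)
Section Ideals.
Variable A : comNzRingType.
Implicit Types (G I J P : A -> Prop) (f g : A).

Definition ideq I J : Prop := forall f, I f <-> J f.

Definition idsub I J : Prop := forall f, I f -> J f.

Definition ideal_gen G : A -> Prop := fun f =>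
  exists (k : nat) (c g : 'I_k -> A),
    (forall i, G (g i)) /\ f = \sum_(i < k) c i * g i.

Definition ideal_sum I J : A -> Prop := fun f =>
  exists g h, [/\ I g, J h & f = g + h].

Definition ideal_prod I J : A -> Prop :=
  ideal_gen (fun f => exists g h, [/\ I g, J h & f = g * h]).

Definition colon I f : A -> Prop := fun g => I (g * f).

Definition is_ideal I : Prop :=
  [/\ I 0, (forall f g, I f -> I g -> I (f + g))
    & forall c f, I f -> I (c * f)].

Definition is_prime_ideal P : Prop :=
  [/\ is_ideal P, ~ P 1 & forall f g, P (f * g) -> P f \/ P g].

(* [colon I g] is the annihilator of the class of [g] in [A / I]. *)
Definition assoc_prime I P : Prop :=
  is_prime_ideal P /\ exists g, ideq (colon I g) P.

End Ideals.

Definition ideal_ext (A B : comNzRingType) (phi : A -> B) (I : A -> Prop) :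
    B -> Prop :=
  ideal_gen (fun g => exists2 f, I f & g = phi f).

Section Graded.
Variables (K : fieldType) (N : nat).
Local Notation S := {mpoly K[N]}.
Implicit Types (I : S -> Prop).

Definition sqfree_ideal (a : nat) : S -> Prop :=
  ideal_gen (fun f => exists mu : 'X_{1..N},
    [/\ mdeg mu = a, (forall i, (mu i <= 1)%N) & f = 'X_[mu]]).

Definition max_ideal : S -> Prop :=
  ideal_gen (fun f => exists i : 'I_N, f = 'X_i).

Definition vdegree I (d : nat) : Prop :=
  exists f : S, f \is d.-homog /\
    exists P, assoc_prime I P /\ ideq (colon I f) P.

(* The lower bound [d0] matters only when I itself is prime: a constant f is
   then allowed for d0 = 0, giving the value 0, but excluded for d0 = 1. *)
Definition is_min_vdegree (d0 : nat) I (v : nat) : Prop :=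
  [/\ (d0 <= v)%N, vdegree I v
    & forall d, (d0 <= d)%N -> vdegree I d -> (v <= d)%N].

Definition is_vnumber I (v : nat) : Prop :=
  (ideq I max_ideal /\ v = 0%N) \/
  [/\ idsub I max_ideal, ~ ideq I max_ideal & is_min_vdegree 1 I v].

(* The i-th module is the direct sum of the S(- fr_shift i k), k < fr_rank i,
   its elements being row vectors; maps act by right multiplication.  The
   column [fr_aug] lifts the augmentation from the 0-th module to S / I. *)
Record free_complex := FreeComplex {
  fr_rank : nat -> nat;
  fr_shift : forall i, 'I_(fr_rank i) -> int;
  fr_aug : 'cV[S]_(fr_rank 0);
  fr_diff : forall i, 'M[S]_(fr_rank i.+1, fr_rank i)
}.

(* Multiplication by [f] is a degree-preserving map S(- e) -> S(- d); this
   forces [f = 0] when e < d. *)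
Definition graded_entry (e d : int) (f : S) : Prop :=
  forall mu : 'X_{1..N}, mu \in msupp f -> (mdeg mu)%:Z + d = e.

Definition is_graded_free_resolution I (F : free_complex) : Prop :=
  [/\ (forall k, graded_entry (fr_shift k) 0 (fr_aug F k 0))
        /\ (forall i k l,
              graded_entry (fr_shift k) (fr_shift l) (fr_diff F i k l)),
      exists u : 'rV_(fr_rank F 0), I (1 - (u *m fr_aug F) 0 0),
      (forall u : 'rV_(fr_rank F 0),
         I ((u *m fr_aug F) 0 0) <-> exists w, u = w *m fr_diff F 0)
    & (forall i (u : 'rV_(fr_rank F i.+1)),
         u *m fr_diff F i = 0 <-> exists w, u = w *m fr_diff F i.+1)].

Definition is_minimal (F : free_complex) : Prop :=
  forall i k l, max_ideal (fr_diff F i k l).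

Definition betti (F : free_complex) (i : nat) (j : int) : nat :=
  #|[set k : 'I_(fr_rank F i) | fr_shift k == j]|.

(* [rho] is the regularity of S / I. *)
Definition is_regularity I (rho : int) : Prop :=
  exists F : free_complex,
    [/\ is_graded_free_resolution I F, is_minimal F,
        (exists i j, betti F i j <> 0%N /\ rho = j - i%:Z)
      & (forall i j, betti F i j <> 0%N -> j - i%:Z <= rho)].

End Graded.

Arguments sqfree_ideal : clear implicits.

Section MixedProducts.
Variables (K : fieldType) (n m : nat).

Definition x_incl (p : {mpoly K[n]}) : {mpoly K[n + m]} :=
  p \mPo [tuple 'X_(lshift m i) | i < n].

Definition y_incl (p : {mpoly K[m]}) : {mpoly K[n + m]} :=
  p \mPo [tuple 'X_(rshift n j) | j < m].

Definition Ix (a : nat) : {mpoly K[n + m]} -> Prop :=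
  ideal_ext x_incl (sqfree_ideal K n a).

Definition Jy (b : nat) : {mpoly K[n + m]} -> Prop :=
  ideal_ext y_incl (sqfree_ideal K m b).

End MixedProducts.

Arguments Ix : clear implicits.
Arguments Jy : clear implicits.

(* Main.v *)
From HB Require Import structures.
Require Import Defs.
From mathcomp Require Import all_boot all_order all_algebra.
From Stdlib Require Import Classical.

Import Order.TTheory GRing.Theory Num.Theory.
Local Open Scope ring_scope.

(** All five ideals are monomial: membership of f only depends on the number
    xsupp of x-variables and the number ysupp of y-variables dividing each
    monomial of f.  This makes colon ideals by monomials explicit: for
    f = x_1 .. x_a y_1 .. y_b, the ideal (I : f) is generated by a set of
    variables, hence prime, as soon as a and b are chosen one step below (or
    at) the thresholds that define I ([vdegree_front]).  Each such f bounds the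
    v-number by a + b, and it remains to exhibit a shift of the given minimal
    resolution which forces the regularity up to a + b.

    For every ideal except I_q + J_t the choice is a = q - 1 together with
    b = 0 for I_q and b = r otherwise.  The monomial x_1 .. x_q y_1 .. y_b lies
    in I and is divisible by exactly q of the x-variables, whereas an element
    of I of degree less than q + b has more than q x-variables in each of its
    monomials.  So I is not generated in degrees below q + b, the first module
    of the resolution has a shift at least q + b, and the regularity is at
    least q + b - 1 = a + b ([generator_shift_ge]).

    For I_q + J_t, with a = q - 1 and b = t - 1, generators only give
    max(q, t) - 1.  The shift needed is q + t in the second module, and it comes
    from the Koszul syzygy between X = x_1 .. x_q and Y = y_1 .. y_t
    ([syzygy_shift_ge]).  To see that this syzygy is not a combination of
    syzygies of smaller degree, send every x_i to u and every y_j to v: the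
    ideal goes into (u^q, v^t).  If g_k are the generators given by the
    resolution, let M(z) = sum_k [u^0] z_k * [u^q] g_k in K[v], computed after
    this substitution.  M is linear, and comparing coefficients of u^q in
    sum_k z_k g_k = 0 shows that v^t divides M(z) for every syzygy z.  On a
    syzygy of degree less than q + t, M(z) is homogeneous of degree less than t,
    hence zero; on the Koszul syzygy, it has v^t-coefficient 1. *)

Set Implicit Arguments.
Unset Strict Implicit.

(** * Ideals as predicates *)

Section IdealFacts.
Variable A : comNzRingType.
Implicit Types (G I J : A -> Prop) (f g : A).

Lemma ideq_sym I J : ideq I J -> ideq J I.
Proof. by move=> IJ f; split=> /IJ. Qed.

Lemma ideq_trans J I L : ideq I J -> ideq J L -> ideq I L.
Proof. by move=> IJ JL f; rewrite IJ. Qed.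

Lemma is_ideal_sum I (T : Type) (r : seq T) (P : pred T) (F : T -> A) :
  is_ideal I -> (forall i, P i -> I (F i)) -> I (\sum_(i <- r | P i) F i).
Proof. by case=> I0 ID _ IF; apply: big_ind. Qed.

Lemma ideal_gen_sub G J : is_ideal J -> idsub G J -> idsub (ideal_gen G) J.
Proof.
move=> idJ GJ f [k [c [g [Gg ->]]]]; apply: is_ideal_sum => // i _.
by case: idJ => _ _; apply; apply: GJ.
Qed.

Lemma ideal_gen_mull G c g : G g -> ideal_gen G (c * g).
Proof.
by move=> Gg; exists 1%N, (fun=> c), (fun=> g); rewrite big_ord1.
Qed.

Lemma ideal_gen_mem G g : G g -> ideal_gen G g.
Proof. by move=> Gg; rewrite -[g]mul1r; apply: ideal_gen_mull. Qed.

Lemma ideal_gen_ideal G : is_ideal (ideal_gen G).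
Proof.
split.
- by exists 0%N, (fun=> 0), (fun=> 0); rewrite big_ord0; split=> // -[].
- move=> f1 f2 [k1 [c1 [g1 [G1 ->]]]] [k2 [c2 [g2 [G2 ->]]]].
  pose glue (u1 : 'I_k1 -> A) (u2 : 'I_k2 -> A) i :=
    match split i with inl j => u1 j | inr j => u2 j end.
  exists (k1 + k2)%N, (glue c1 c2), (glue g1 g2); split.
    by rewrite /glue => i; case: (split i).
  rewrite big_split_ord /=; congr (_ + _); apply: eq_bigr => i _.
    by rewrite /glue -[lshift _ _]/(unsplit (inl i)) unsplitK.
  by rewrite /glue -[rshift _ _]/(unsplit (inr i)) unsplitK.
- move=> c _ [k [d [g [Gg ->]]]]; exists k, (fun i => c * d i), g; split=> //.
  by rewrite mulr_sumr; apply: eq_bigr => i _; rewrite mulrA.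
Qed.

Lemma ker_prime (B : idomainType) (phi : {rmorphism A -> B}) I :
  (forall f, I f <-> phi f = 0) -> is_prime_ideal I.
Proof.
move=> Iphi; split=> [||f g].
- split=> [|f g|c f]; rewrite !Iphi ?rmorph0 //.
    by rewrite rmorphD => -> ->; rewrite addr0.
  by rewrite rmorphM => ->; rewrite mulr0.
- by rewrite Iphi rmorph1; apply/eqP/oner_neq0.
- rewrite !Iphi rmorphM => /eqP; rewrite mulf_eq0 => /orP[] /eqP; tauto.
Qed.

End IdealFacts.

(** * Monomial ideals *)

Section MonomialIdeals.
Variables (K : fieldType) (N : nat).
Local Notation S := {mpoly K[N]}.
Local Notation mon := 'X_{1..N}.
Implicit Types (U V W : pred mon) (mu nu : mon) (f g : S).

Definition monI U : S -> Prop := fun f => forall mu, mu \in msupp f -> U mu.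

Definition up_closed U := forall mu nu, U mu -> U (nu + mu)%MM.

Lemma monI_ext U V : U =1 V -> ideq (monI U) (monI V).
Proof. by move=> UV f; split=> If mu /If; rewrite UV. Qed.

Lemma monI_X U mu : monI U 'X_[mu] <-> U mu.
Proof.
rewrite /monI msuppX; split=> [|Umu nu]; last by rewrite inE => /eqP->.
by apply; rewrite inE.
Qed.

Lemma monI_ideal U : up_closed U -> is_ideal (monI U).
Proof.
move=> upU; split=> [mu|f g If Ig mu|c f If mu].
- by rewrite msupp0.
- by move/msuppD_le; rewrite mem_cat => /orP[/If|/Ig].
- by case/msuppM_le/allpairsP=> -[a b] /= [_ /If Ub ->]; apply: upU.
Qed.

Lemma monI_sub U (J : S -> Prop) :
  is_ideal J -> (forall mu, U mu -> J 'X_[mu]) -> idsub (monI U) J.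
Proof.
move=> idJ UJ f If; rewrite (mpolyE f) big_seq_cond.
apply: is_ideal_sum => // mu; rewrite andbT => /If/UJ Jmu.
by rewrite -mul_mpolyC; case: idJ => _ _; apply.
Qed.

Lemma monI_sum U V I J : ideq I (monI U) -> ideq J (monI V) ->
  ideq (ideal_sum I J) (monI (predU U V)).
Proof.
move=> IU JV f; split=> [[g [h [/IU Ug /JV Vh ->]]] mu|If].
  by move/msuppD_le; rewrite mem_cat => /orP[/Ug|/Vh] /= ->; rewrite ?orbT.
have part (P : pred mon) mu :
    mu \in msupp (\sum_(nu <- msupp f | P nu) f@_nu *: 'X_[nu]) ->
    (mu \in msupp f) && P mu.
  move/msupp_sum_le => /flattenP[s].
  case/mapP=> nu; rewrite mem_filter => /andP[Pnu f_nu] ->.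
  by move/msuppZ_le; rewrite msuppX inE => /eqP->; rewrite f_nu Pnu.
exists (\sum_(mu <- msupp f | U mu) f@_mu *: 'X_[mu]).
exists (\sum_(mu <- msupp f | ~~ U mu) f@_mu *: 'X_[mu]); split.
- by apply/IU => mu /part/andP[].
- by apply/JV => mu /part/andP[/If /=/orP[->|]].
- by rewrite {1}(mpolyE f) (bigID U).
Qed.

(** Stated for an arbitrary W rather than for the set of all products, so that
    W can be the closed-form condition that describes the product. *)
Lemma monI_prod U V W I J : ideq I (monI U) -> ideq J (monI V) -> up_closed W ->
    (forall mu nu, U mu -> V nu -> W (mu + nu)%MM) ->
    (forall mu, W mu -> exists a b, [/\ U a, V b & mu = (a + b)%MM]) ->
  ideq (ideal_prod I J) (monI W).
Proof.
move=> IU JV upW UVW WUV f; split; move: f.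
  apply: ideal_gen_sub; first exact: monI_ideal.
  move=> _ [g [h [/IU Ug /JV Vh ->]]] mu /msuppM_le/allpairsP[[a b] /=].
  by case=> /Ug Ua /Vh Vb ->; apply: UVW.
apply: monI_sub; first exact: ideal_gen_ideal.
move=> mu /WUV[a [b [Ua Vb ->]]]; rewrite mpolyXD; apply: ideal_gen_mem.
by exists 'X_[a], 'X_[b]; split=> //; [apply/IU/monI_X | apply/JV/monI_X].
Qed.

Lemma colon_monI U mu :
  ideq (colon (monI U) 'X_[mu]) (monI (fun nu => U (mu + nu)%MM)).
Proof.
move=> f; rewrite /colon; split=> If nu.
  move=> f_nu; apply: If; rewrite (perm_mem (msuppMX _ _)).
  by apply/mapP; exists nu.
by rewrite (perm_mem (msuppMX _ _)) => /mapP[nu' /If U_nu ->].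
Qed.

Definition meets (T : pred 'I_N) : pred mon :=
  fun mu => [exists i, T i && (mu i != 0%N)].

(** This is the ideal generated by the variables in T: it is the kernel of the
    substitution of 0 for these variables, whose target is a domain. *)
Lemma monI_meets_prime T : is_prime_ideal (monI (meets T)).
Proof.
pose lq := [tuple if T i then 0 else 'X_i : S | i < N].
have lqX mu : 'X_[mu] \mPo lq = if meets T mu then 0 else 'X_[mu].
  rewrite comp_mpolyX; case: ifP => [/existsP[i /andP[Ti mui]]|/existsPn noT].
    by rewrite (bigD1 i) //= tnth_mktuple Ti expr0n (negPf mui) mul0r.
  rewrite [RHS]mpolyXE_id; apply: eq_bigr => i _; rewrite tnth_mktuple.
  case: ifP => // Ti; move: (noT i); rewrite Ti negbK => /eqP->.
  by rewrite !expr0.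
have lqE f : f \mPo lq =
    \sum_(mu <- msupp f) if meets T mu then 0 else f@_mu *: 'X_[mu].
  rewrite {1}(mpolyE f) raddf_sum; apply: eq_bigr => mu _ /=.
  by rewrite comp_mpolyZ lqX; case: ifP; rewrite ?scaler0.
apply: (@ker_prime _ _ (comp_mpoly lq)) => f.
rewrite -[X in _ <-> X = 0]/(f \mPo lq) lqE; split=> [If|].
  by rewrite big_seq big1 // => mu /If ->.
move=> f0 mu f_mu; apply: contraT => mu_T.
move/(congr1 (mcoeff mu)): f0; rewrite mcoeff0 raddf_sum /=.
rewrite (bigD1_seq mu) ?msupp_uniq //= (negPf mu_T) mcoeffZ mcoeffX eqxx mulr1.
rewrite big1 ?addr0 => [f0|nu /negPf nu_mu].
  by move: f_mu; rewrite mcoeff_msupp f0 eqxx.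
by case: ifP; rewrite ?mcoeff0 // mcoeffZ mcoeffX nu_mu mulr0.
Qed.

Lemma max_ideal_monI : ideq (@max_ideal K N) (monI (fun mu => mu != 0%MM)).
Proof.
move=> f; split; move: f.
  apply: ideal_gen_sub.
    by apply: monI_ideal => mu nu; rewrite mnmD_eq0 negb_and => ->; rewrite orbT.
  by move=> _ [i ->]; apply/monI_X; rewrite mnm1_eq0.
apply: monI_sub; first exact: ideal_gen_ideal.
move=> mu mu0; have /existsP[i mui] : [exists i, mu i != 0%N].
  apply: contraR mu0 => /existsPn mu0; apply/eqP/mnmP=> i.
  by rewrite mnm0E; apply/eqP; rewrite -[_ == _]negbK mu0.
have -> : mu = (mu - U_(i) + U_(i))%MM.
  rewrite submK //; apply/mnm_lepP => j; rewrite mnm1E.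
  by case: eqP => // <-; rewrite lt0n.
by rewrite mpolyXD; apply: ideal_gen_mull; exists i.
Qed.

(** * Square-free Veronese ideals and their sums and products *)

Section Veronese.
Variables (p : nat) (h : 'I_p -> 'I_N) (h_inj : injective h).

Definition nvars (mu : mon) := #|[set i | mu (h i) != 0%N]|.

Lemma nvars_le mu nu : (forall i, mu (h i) != 0 -> nu (h i) != 0)%N ->
  (nvars mu <= nvars nu)%N.
Proof.
by move=> mn; apply/subset_leq_card/subsetP => i; rewrite !inE; apply: mn.
Qed.

Lemma nvarsD mu nu : (nvars mu <= nvars (nu + mu)%MM)%N.
Proof.
by apply: nvars_le => i; rewrite mnmDE addn_eq0 negb_and orbC => ->.
Qed.

Let push (nu : 'X_{1..p}) : mon := (\sum_i (U_(h i) *+ nu i))%MM.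

Let push_h (nu : 'X_{1..p}) i : push nu (h i) = nu i.
Proof.
rewrite mnm_sumE (bigD1 i) //= mulmnE mnm1E eqxx /= mul1n big1 ?addn0 //.
move=> j ji.
by rewrite mulmnE mnm1E (inj_eq h_inj) (negPf ji).
Qed.

Let pushN (nu : 'X_{1..p}) k : k \notin codom h -> push nu k = 0%N.
Proof.
move=> hk; rewrite mnm_sumE big1 // => j _; rewrite mulmnE mnm1E.
by case: eqP => // hj; case/codomP: hk; exists j.
Qed.

(** Treats the x- and the y-variables at once: h is the inclusion of the p
    variables into all N of them.  A monomial divisible by at least a of these
    variables is a multiple of the product of any a of them. *)
Lemma veroneseE a :
  ideq (ideal_ext (comp_mpoly [tuple 'X_(h i) : S | i < p]) (sqfree_ideal K p a))
       (monI (fun mu => a <= nvars mu)%N).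
Proof.
have compX (nu : 'X_{1..p}) :
    'X_[nu] \mPo [tuple 'X_(h i) : S | i < p] = 'X_[push nu].
  rewrite comp_mpolyX /push (big_morph _ (@mpolyXD _ _) (@mpolyX0 _ _)).
  by apply: eq_bigr => i _; rewrite tnth_mktuple mpolyXn.
have up : up_closed (fun mu => a <= nvars mu)%N.
  by move=> mu nu /leq_trans-> //; apply: nvarsD.
move=> f; split; move: f.
  apply: ideal_gen_sub => [|_ [f [k [c [g [Gg ->]]]] ->]]; first exact: monI_ideal.
  rewrite raddf_sum; apply: is_ideal_sum => [|i _]; first exact: monI_ideal.
  rewrite /= rmorphM; have [_ _] := monI_ideal up; apply.
  have [mu [<- mu1 ->]] := Gg i.
  rewrite [X in monI _ X]compX; apply/monI_X.
  rewrite mdegE /nvars -sum1_card [leqRHS]big_mkcond; apply: leq_sum => j _.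
  by rewrite inE push_h; case: (mu j) (mu1 j) => [|[]].
apply: monI_sub; first exact: ideal_gen_ideal.
move=> mu a_mu; pose B := [set:: take a (enum [set i | mu (h i) != 0%N])].
have cardB : #|B| = a.
  rewrite cardsE.
  have /card_uniqP-> := take_uniq a (enum_uniq [set i | mu (h i) != 0%N]).
  by rewrite size_takel // -cardE.
have Bmu i : i \in B -> mu (h i) != 0%N.
  by rewrite inE => /mem_take; rewrite mem_enum inE.
pose nu := [multinom (i \in B : nat) | i < p].
have -> : mu = (mu - push nu + push nu)%MM.
  rewrite submK //; apply/mnm_lepP => k; have [/codomP[i ->]|/pushN-> //] :=
    boolP (k \in codom h).
  by rewrite push_h mnmE; case: (boolP (i \in B)) => // /Bmu; rewrite lt0n.
rewrite mpolyXD -compX; apply: ideal_gen_mull; exists 'X_[nu] => //.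
apply: ideal_gen_mem; exists nu; split=> [|i|//].
  rewrite mdegE -cardB -sum1_card [RHS]big_mkcond; apply: eq_bigr => i _.
  by rewrite mnmE; case: (i \in B).
by rewrite mnmE; case: (i \in B).
Qed.

End Veronese.
End MonomialIdeals.

Lemma sum_ltn p a : (a <= p)%N -> (\sum_(i < p) (i < a)%N = a)%N.
Proof.
move=> ap; rewrite -[RHS]muln1 -[X in (X * _)%N]card_ord -sum_nat_const.
rewrite (big_ord_widen _ (fun=> 1%N) ap) [RHS]big_mkcond.
by apply: eq_bigr => i _; case: (i < a)%N.
Qed.

Section VeroneseFacts.
Variables (N p : nat) (h : 'I_p -> 'I_N).
Implicit Types (mu nu w : 'X_{1..N}).

Lemma nvars_le_deg mu : (nvars h mu <= \sum_i mu (h i))%N.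
Proof.
rewrite /nvars -sum1_card big_mkcond; apply: leq_sum => i _.
by rewrite inE; case: (mu (h i)).
Qed.

(** The threshold test behind the colon ideals below: w already contains the
    first a variables, so only a later variable in nu enlarges its support. *)
Lemma nvars_front w nu a : (a <= p)%N -> (forall i : 'I_p, w (h i) = (i < a)%N) ->
  (a <= nvars h (w + nu)%MM)%N /\
  (a < nvars h (w + nu)%MM)%N = [exists i : 'I_p, (a <= i)%N && (nu (h i) != 0%N)].
Proof.
move=> ap wE; pose A := [set i : 'I_p | (i < a)%N].
have cardA : #|A| = a.
  rewrite -sum1_card big_mkcond -[RHS](sum_ltn ap); apply: eq_bigr => i _.
  by rewrite inE; case: (i < a)%N.
have sub : A \subset [set i | (w + nu)%MM (h i) != 0%N].
  by apply/subsetP=> i; rewrite !inE mnmDE wE => ->.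
split; first by rewrite -{1}cardA; apply: subset_leq_card.
apply/idP/existsP => [lt_a|[i /andP[ai nui]]]; last first.
  rewrite -{1}cardA; apply: proper_card; apply/properP; split=> //.
  by exists i; rewrite !inE ?mnmDE ?addn_eq0 ?(negPf nui) ?andbF // -leqNgt.
have /subsetPn[i] : ~~ ([set i | (w + nu)%MM (h i) != 0%N] \subset A).
  by apply: contraL lt_a => /subset_leq_card; rewrite cardA -leqNgt.
rewrite !inE mnmDE wE -leqNgt => nui ai; exists i; rewrite ai.
by move: nui; rewrite ltnNge ai.
Qed.

Lemma nvars_front0 w a : (a <= p)%N -> (forall i : 'I_p, w (h i) = (i < a)%N) ->
  nvars h w = a.
Proof.
move=> ap wE; have [] := nvars_front 0%MM ap wE; rewrite addm0 => le_a lt_a.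
apply/eqP; rewrite eqn_leq le_a leqNgt lt_a andbT; apply/existsPn => i.
by rewrite mnm0E eqxx andbF.
Qed.

End VeroneseFacts.

Section Bigraded.
Variables (K : fieldType) (n m : nat).
Local Notation S := {mpoly K[n + m]}.
Local Notation mon := 'X_{1..n + m}.
Implicit Types (U : pred mon) (mu nu : mon) (I : S -> Prop).

Definition xsupp mu := nvars (@lshift n m) mu.
Definition ysupp mu := nvars (@rshift n m) mu.

Lemma Ix_monI a : ideq (Ix K n m a) (monI (fun mu => a <= xsupp mu)%N).
Proof. exact: (@veroneseE K _ _ _ (@lshift_inj n m) a). Qed.

Lemma Jy_monI b : ideq (Jy K n m b) (monI (fun mu => b <= ysupp mu)%N).
Proof. exact: (@veroneseE K _ _ _ (@rshift_inj n m) b). Qed.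

Lemma IxJy_monI a b : ideq (ideal_prod (Ix K n m a) (Jy K n m b))
  (monI (fun mu => (a <= xsupp mu) && (b <= ysupp mu))%N).
Proof.
apply: (monI_prod (@Ix_monI a) (@Jy_monI b)).
- move=> mu nu /andP[a_mu b_mu].
  by rewrite (leq_trans a_mu (nvarsD _ _ _)) (leq_trans b_mu (nvarsD _ _ _)).
- move=> mu nu /= a_mu b_nu; rewrite (leq_trans b_nu (nvarsD _ _ _)) andbT addmC.
  exact: leq_trans a_mu (nvarsD _ _ _).
move=> mu /andP[a_mu b_mu].
(* [part true] is the x-part of mu and [part false] its y-part. *)
pose part (c : bool) :=
  [multinom if split i is inl _ then mu i * c else mu i * ~~ c : nat
  | i < n + m]%N.
exists (part true), (part false); split.
- apply: leq_trans a_mu (nvars_le _) => i; rewrite mnmE.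
  by rewrite -[lshift _ _]/(unsplit (inl i)) unsplitK muln1.
- apply: leq_trans b_mu (nvars_le _) => i; rewrite mnmE.
  by rewrite -[rshift _ _]/(unsplit (inr i)) unsplitK muln1.
- apply/mnmP => i; rewrite mnmDE !mnmE.
  by case: (split i) => _; rewrite muln1 muln0 ?addn0.
Qed.

(** The exponent of x_1 .. x_a y_1 .. y_b. *)
Definition front a b : mon :=
  [multinom match split k with inl i => (i < a)%N | inr j => (j < b)%N end : nat
  | k < n + m].

Lemma front_l a b (i : 'I_n) : front a b (lshift m i) = (i < a)%N.
Proof. by rewrite mnmE -[lshift _ _]/(unsplit (inl i)) unsplitK. Qed.

Lemma front_r a b (j : 'I_m) : front a b (rshift n j) = (j < b)%N.
Proof. by rewrite mnmE -[rshift _ _]/(unsplit (inr j)) unsplitK. Qed.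

Definition xdeg mu := (\sum_(i < n) mu (lshift m i))%N.
Definition ydeg mu := (\sum_(j < m) mu (rshift n j))%N.

Lemma mdeg_xy mu : mdeg mu = (xdeg mu + ydeg mu)%N.
Proof. by rewrite mdegE big_split_ord. Qed.

Lemma xdeg_front a b : (a <= n)%N -> xdeg (front a b) = a.
Proof.
by move=> an; rewrite -[RHS](sum_ltn an); apply: eq_bigr => i _; rewrite front_l.
Qed.

Lemma ydeg_front a b : (b <= m)%N -> ydeg (front a b) = b.
Proof.
by move=> bm; rewrite -[RHS](sum_ltn bm); apply: eq_bigr => i _; rewrite front_r.
Qed.

(** The source of all upper bounds on the v-number.  Near the monomial
    f = x_1 .. x_a y_1 .. y_b, membership in I only asks for an (a+1)-st
    x-variable or, when c holds, a (b+1)-st y-variable; so (I : f) is generated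
    by the variables x_i with i > a and, when c holds, the y_j with j > b. *)
Lemma vdegree_front U I a b (c : bool) :
    (a <= n)%N -> (b <= m)%N -> ideq I (monI U) ->
    (forall nu, U (front a b + nu)%MM =
       (a < xsupp (front a b + nu)%MM)%N || c && (b < ysupp (front a b + nu)%MM)%N) ->
  vdegree I (a + b).
Proof.
move=> an bm IU Ufront.
pose T (k : 'I_(n + m)) :=
  match split k with inl i => (a <= i)%N | inr j => c && (b <= j)%N end.
have TE : ideq (colon I 'X_[front a b]) (monI (meets T)).
  apply: (ideq_trans (J := colon (monI U) 'X_[front a b])).
    by move=> f; apply: IU.
  apply: (ideq_trans (colon_monI _ _)); apply: monI_ext.
  move=> nu; rewrite Ufront /xsupp /ysupp.
  have [_ ->] := nvars_front nu an (front_l a b).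
  have [_ ->] := nvars_front nu bm (front_r a b).
  apply/orP/existsP => [[/existsP[i nui]|/andP[c1 /existsP[j nuj]]]|[k]].
  - by exists (lshift m i); rewrite /T -[lshift _ _]/(unsplit (inl i)) unsplitK.
  - by exists (rshift n j); rewrite /T -[rshift _ _]/(unsplit (inr j)) unsplitK c1.
  rewrite /T -[k]splitK; case: (split k) => i; rewrite unsplitK => Ti.
    by left; apply/existsP; exists i.
  by right; case/andP: Ti => /andP[-> ai] nui; apply/existsP; exists i; rewrite ai.
exists 'X_[front a b]; split.
  rewrite dhomogX; apply/eqP; apply: etrans (mdeg_xy _) _.
  by rewrite xdeg_front ?ydeg_front.
exists (monI (meets T)); split=> //; split; first exact: monI_meets_prime.
by exists 'X_[front a b].
Qed.

End Bigraded.

(** * Low-degree part of a graded free resolution *)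

Section Resolution.
Variables (K : fieldType) (N : nat).
Local Notation S := {mpoly K[N]}.

Lemma graded_entry_sum e d (T : finType) (F : T -> S) :
  (forall k, graded_entry e d (F k)) -> graded_entry e d (\sum_k F k).
Proof.
move=> gF mu /msupp_sum_le/flattenP[s /mapP[k _ ->]]; exact: gF.
Qed.

Lemma graded_entryM e d c (f g : S) :
  graded_entry e d f -> graded_entry d c g -> graded_entry e c (f * g).
Proof.
move=> gf gg mu /msuppM_le/allpairsP[[a b] /= [/gf ga /gg gb ->]].
by rewrite mdegD PoszD -addrA gb.
Qed.

Variables (I : S -> Prop) (F : free_complex K N).
Hypotheses (I0 : forall f, I f -> f@_0%MM = 0)
  (resF : is_graded_free_resolution I F).

(** Since I has no constant terms, lifting 1 to the 0-th module forces an entry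
    of the augmentation to have a nonzero constant term; homogeneity makes this
    entry a constant. *)
Lemma aug_unit : exists k0 c, c != 0 /\ fr_aug F k0 0 = c%:MP.
Proof.
case: resF => -[aug_gr _] [u /I0 u1] _ _.
have [k nz] : exists k, (fr_aug F k 0)@_0%MM != 0.
  apply/existsP; apply: contraT => /existsPn a0; move/eqP: u1.
  rewrite mcoeffB mcoeff1 eqxx mxE raddf_sum big1 ?subr0 ?oner_eq0 // => k _ /=.
  by move/negbNE/eqP: (a0 k) => a0k; rewrite [LHS]rmorphM /= a0k mulr0.
exists k, (fr_aug F k 0)@_0%MM; split=> //; apply/mpolyP => mu; rewrite mcoeffC.
case: eqP => [->|/eqP mu0]; rewrite ?mulr1 // mulr0.
apply/eqP; rewrite mcoeff_eq0; apply/negP => /aug_gr.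
move: nz; rewrite -mcoeff_msupp => /aug_gr; rewrite mdeg0 => <- /addIr/eqP.
by rewrite eqz_nat mdeg_eq0 (negPf mu0).
Qed.

(** The generators of I that the resolution provides: images in S of the basis
    of the first module. *)
Definition res_gens : 'cV[S]_(fr_rank F 1) := fr_diff F 0 *m fr_aug F.

Lemma res_gens_mem k : I (res_gens k 0).
Proof.
case: resF => _ _ exact0 _.
have -> : res_gens k 0 = (row k (fr_diff F 0) *m fr_aug F) 0 0.
  by rewrite -row_mul [RHS]mxE.
by apply/exact0; exists (delta_mx 0 k); rewrite rowE.
Qed.

Lemma res_gens_graded k : graded_entry (fr_shift k) 0 (res_gens k 0).
Proof.
case: resF => -[aug_gr diff_gr] _ _ _; rewrite mxE.
by apply: graded_entry_sum => l; apply: graded_entryM.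
Qed.

Lemma res_gens_span f : I f -> exists w : 'rV_(fr_rank F 1), f = (w *m res_gens) 0 0.
Proof.
have [k0 [c [nz_c augc]]] := aug_unit; case: resF => _ _ exact0 _ If.
pose u : 'rV[S]_(fr_rank F 0) := (c^-1 *: f) *: delta_mx 0 k0.
have uE : (u *m fr_aug F) 0 0 = f.
  rewrite -scalemxAl -rowE !mxE augc mulrC mul_mpolyC scalerA divff //.
  by rewrite scale1r.
have [|w uw] := (exact0 u).1; first by rewrite uE.
by exists w; rewrite mulmxA -uw uE.
Qed.

(** If the generators all had degree less than d, they would all lie in P, and
    so would I. *)
Lemma generator_shift_ge (P : S -> Prop) (d : nat) : is_ideal P ->
    (forall f, I f -> (forall mu, mu \in msupp f -> (mdeg mu < d)%N) -> P f) ->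
    ~ idsub I P ->
  exists k : 'I_(fr_rank F 1), d%:Z <= fr_shift k.
Proof.
move=> idP lowP notIP; apply: NNPP => small; case: notIP => f.
case/res_gens_span=> w ->; rewrite mxE; apply: is_ideal_sum => // k _.
have [_ _ mulP] := idP; apply: (mulP); apply: lowP => [|mu mu_k].
  exact: res_gens_mem.
rewrite -ltz_nat -[X in X < _]addr0 (res_gens_graded mu_k) ltNge.
by apply/negP => dk; apply: small; exists k.
Qed.

Hypothesis minF : is_minimal F.

(** The unit entry c of the augmentation sits at some k0.  For any other index
    k', the element e_k' - (aug k' / c) e_k0 of the 0-th module dies in S / I, so
    it is a boundary; but minimality puts the entries of boundaries in the
    maximal ideal, while the entry of this one at k' is 1. *)
Lemma rank0_subsingleton (k l : 'I_(fr_rank F 0)) : k = l.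
Proof.
have [k0 [c [nz_c augc]]] := aug_unit.
suff eq_k0 k' : k' = k0 by rewrite (eq_k0 k) (eq_k0 l).
apply/eqP; apply: contraT => kk0; case: resF => _ _ exact0 _.
pose u : 'rV[S]_(fr_rank F 0) :=
  delta_mx 0 k' - (c^-1 *: fr_aug F k' 0) *: delta_mx 0 k0.
have I00 : I 0.
  rewrite (_ : 0 = (0 *m fr_aug F : 'M_1) 0 0); last by rewrite mul0mx mxE.
  by apply/exact0; exists 0; rewrite mul0mx.
have [|w uw] := (exact0 u).1.
  rewrite mulmxBl -scalemxAl -!rowE !mxE augc mulrC mul_mpolyC scalerA divff //.
  by rewrite scale1r subrr.
have : (u 0 k')@_0%MM = 1.
  by rewrite !mxE !eqxx (negPf kk0) mulr0 subr0 mcoeff1 eqxx.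
rewrite uw mxE raddf_sum big1 => [/esym/eqP|j _ /=]; first by rewrite oner_eq0.
rewrite [LHS]rmorphM /=; have /max_ideal_monI d0 := minF j k'.
rewrite [X in _ * X](_ : _ = 0) ?mulr0 //; apply/eqP; rewrite mcoeff_eq0.
by apply/negP => /d0; rewrite eqxx.
Qed.

(** The resolution only says that the second module covers the kernel of the
    first differential; as the 0-th module has rank 1 with a unit augmentation,
    that kernel consists of all syzygies of [res_gens]. *)
Lemma res_syz_span (z : 'rV_(fr_rank F 1)) :
  z *m res_gens = 0 -> exists w, z = w *m fr_diff F 1.
Proof.
have [k0 [c [nz_c augc]]] := aug_unit; case: resF => _ _ _ exact1 z0.
apply/exact1; apply/rowP => k; rewrite (rank0_subsingleton k k0) [RHS]mxE.
move/matrixP/(_ 0 0): z0; rewrite mulmxA mxE (bigD1 k0) //= big1 ?addr0.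
  rewrite augc mulrC mul_mpolyC [RHS]mxE => /(congr1 (fun p => c^-1 *: p)).
  by rewrite scalerA mulVf // scale1r scaler0.
by move=> k1; rewrite (rank0_subsingleton k1 k0) eqxx.
Qed.

Lemma res_syz_row k : row k (fr_diff F 1) *m res_gens = 0.
Proof.
case: resF => _ _ _ exact1.
have -> // : row k (fr_diff F 1) *m res_gens = 
   (row k (fr_diff F 1) *m fr_diff F 0) *m fr_aug F by rewrite mulmxA.
suff -> : row k (fr_diff F 1) *m fr_diff F 0 = 0 by rewrite mul0mx.
by apply/exact1; exists (delta_mx 0 k); rewrite rowE.
Qed.

End Resolution.

(** * The Koszul syzygy *)

Section KoszulSyzygy.
Variables (K : fieldType) (n m : nat).
Local Notation S := {mpoly K[n + m]}.
Local Notation mon := 'X_{1..n + m}.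

(** The substitution x_i |-> u, y_j |-> v, where u is the outer and v the inner
    variable of {poly {poly K}}. *)
Definition uv_var (k : 'I_(n + m)) : {poly {poly K}} :=
  match split k with inl _ => 'X | inr _ => 'X%:P end.

Definition to_uv (f : S) : {poly {poly K}} :=
  mmap (polyC \o polyC) uv_var f.

HB.instance Definition _ := GRing.RMorphism.copy to_uv (mmap (polyC \o polyC) uv_var).

Lemma to_uvX (mu : mon) : to_uv 'X_[mu] = 'X^(xdeg mu) * ('X^(ydeg mu))%:P.
Proof.
rewrite /to_uv mmapX /mmap1 big_split_ord /=; congr (_ * _).
  rewrite -prodrXr; apply: eq_bigr => i _.
  by rewrite /uv_var -[lshift _ _]/(unsplit (inl i)) unsplitK.
rewrite rmorphXn /= -prodrXr; apply: eq_bigr => i _.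
by rewrite /uv_var -[rshift _ _]/(unsplit (inr i)) unsplitK.
Qed.

Lemma to_uv_coef f i j : (to_uv f)`_i`_j != 0 ->
  exists mu, [/\ mu \in msupp f, xdeg mu = i & ydeg mu = j].
Proof.
move=> nz; apply: NNPP => no; case/eqP: nz.
rewrite (mpolyE f) raddf_sum /= !coef_sum big_seq big1 // => mu f_mu.
rewrite -mul_mpolyC rmorphM /= to_uvX [to_uv _]mmapC /= coefCM coefMC coefXn.
case: eqP => [ix|_]; last by rewrite mul0r mulr0 coef0.
rewrite mul1r coefCM coefXn; case: eqP => [jy|_]; last by rewrite mulr0.
by case: no; exists mu.
Qed.

(** Modulo v^t every g l is divisible by u^q, so the coefficient of u^q in the
    sum only sees the constant terms in u of the z l.  It is used with h = 0, and
    with h the image of a generator. *)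
Lemma syzygy_coef k (z g : 'I_k -> {poly {poly K}}) h q t :
    (forall l i j, (i < q)%N -> (j < t)%N -> (g l)`_i`_j = 0) ->
    \sum_l z l * g l = h ->
  forall j, (j < t)%N -> (\sum_l (z l)`_0 * (g l)`_q)`_j = h`_q`_j.
Proof.
move=> g0 <- j jt; rewrite !coef_sum; apply: eq_bigr => l _.
rewrite coefMr big_ord_recr /= subnn coefD coef_sum big1 ?add0r // => i _.
rewrite coefM big1 // => j' _; rewrite g0 ?mulr0 ?ltn_ord //.
by apply: leq_ltn_trans jt; apply: leq_subr.
Qed.

(** The Koszul syzygy Y a - X b, where a and b express X and Y through the
    generators, cannot be a combination of syzygies of degree less than q + t: the
    linear map M vanishes on all of these but not on the Koszul syzygy. *)
Lemma syzygy_shift_ge I (F : free_complex K (n + m)) q t X Y :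
    (forall f, I f -> f@_0%MM = 0) -> is_graded_free_resolution I F ->
    is_minimal F ->
    (forall f i j, I f -> (i < q)%N -> (j < t)%N -> (to_uv f)`_i`_j = 0) ->
    (0 < q)%N -> (0 < t)%N -> I X -> I Y ->
    to_uv X = 'X^q -> to_uv Y = ('X^t)%:P ->
  exists k : 'I_(fr_rank F 2), (q + t)%N%:Z <= fr_shift k.
Proof.
move=> I0 resF minF uvI q_gt0 t_gt0 IX IY uvX uvY; apply: NNPP => small.
pose g := res_gens F.
have uvg k i j : (i < q)%N -> (j < t)%N -> (to_uv (g k 0))`_i`_j = 0.
  by apply: uvI; apply: res_gens_mem.
pose M (z : 'rV[S]_(fr_rank F 1)) :=
  \sum_k (to_uv (z 0 k))`_0 * (to_uv (g k 0))`_q.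
have Mcoef z f j : (z *m g) 0 0 = f -> (j < t)%N -> (M z)`_j = (to_uv f)`_q`_j.
  move=> zf; apply: (syzygy_coef (z := fun k => to_uv (z 0 k))) => [k i {}j|].
    exact: uvg.
  by rewrite -zf mxE raddf_sum; apply: eq_bigr => k _; rewrite /= rmorphM.
(* Below v^t the coefficients of M vanish because a row is a syzygy, and from
   v^t on because its degree is too small. *)
have M_row l : M (row l (fr_diff F 1)) = 0.
  apply/polyP => j; rewrite coef0; case: (ltnP j t) => [jt|tj].
    rewrite (@Mcoef _ 0) ?(res_syz_row resF) ?mxE //.
    by rewrite [to_uv _]raddf0 !coef0.
  rewrite coef_sum big1 // => k _; rewrite coefM big1 // => j1 _; apply/eqP.
  apply: contraT; rewrite mulf_eq0 negb_or mxE => /andP[].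
  case/to_uv_coef=> mu [d_mu mu_x mu_y] /to_uv_coef[nu [g_nu nu_x nu_y]].
  case: small; exists l; have [[_ dgr] _ _ _] := resF.
  rewrite -(dgr _ _ _ _ d_mu) -(res_gens_graded resF g_nu) addr0 -PoszD lez_nat.
  rewrite !mdeg_xy mu_x mu_y nu_x nu_y add0n addnCA subnKC ?leq_add2l //.
  by rewrite -ltnS.
have [a aX] := res_gens_span I0 resF IX.
have [b bY] := res_gens_span I0 resF IY.
pose z := Y *: a - X *: b.
have [|w zw] := res_syz_span I0 resF minF (z := z).
  apply/matrixP => i j; rewrite !ord1 mulmxBl -!scalemxAl.
  rewrite mxE [X in X + _]mxE [X in _ + X]mxE [X in _ - X]mxE -aX -bY mxE mulrC.
  by rewrite subrr.
have Mz0 : M z = 0.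
  rewrite /M zw; under eq_bigr => k _.
    rewrite mxE raddf_sum coef_sum mulr_suml; over.
  rewrite exchange_big big1 // => l _ /=.
  transitivity ((to_uv (w 0 l))`_0 * M (row l (fr_diff F 1))); last first.
    by rewrite M_row mulr0.
  rewrite /M mulr_sumr; apply: eq_bigr => k _.
  by rewrite rmorphM coef0M mulrA !mxE.
have MzE : M z = 'X^t * M a.
  rewrite /M mulr_sumr; apply: eq_bigr => k _; rewrite !mxE rmorphB !rmorphM /=.
  rewrite uvX uvY coefB !coef0M coefC eqxx coefXn eq_sym -[_ == _]negbK -lt0n.
  rewrite q_gt0.
  by rewrite mul0r subr0 mulrA.
move/(congr1 (fun p : {poly K} => p`_t)): Mz0.
rewrite MzE coefXnM ltnn subnn (Mcoef _ X) // uvX coefXn eqxx coef1 coef0.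
by move/eqP; rewrite oner_eq0.
Qed.

End KoszulSyzygy.

(** * Comparison of the v-number with the regularity *)

Section VNumberBound.
Variables (K : fieldType) (n m : nat).
Local Notation S := {mpoly K[n + m]}.
Implicit Types (U : pred 'X_{1..n + m}) (I : S -> Prop).

Lemma min_vdegree_exists I d0 d : (d0 <= d)%N -> vdegree I d ->
  exists2 v, (v <= d)%N & is_min_vdegree d0 I v.
Proof.
elim/ltn_ind: d => d IHd d0d vd.
have [[e [d0e ed ve]]|min_d] :=
    classic (exists e, [/\ (d0 <= e)%N, (e < d)%N & vdegree I e]).
  have [v ve' min_v] := IHd e ed d0e ve; exists v => //.
  exact: leq_trans ve' (ltnW ed).
exists d => //; split=> // e d0e ve; rewrite leqNgt; apply/negP => ed.
by apply: min_d; exists e.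
Qed.

Lemma vdegree_Ix1 I : ideq I (Ix K n m 1) -> vdegree I 0.
Proof.
move=> I1; have IU := ideq_trans I1 (@Ix_monI K n m 1); rewrite -[0%N]/(0 + 0)%N.
by apply: (vdegree_front (c := false) _ _ IU) => // nu; rewrite orbF.
Qed.

(** Reduces the theorem to one witness of degree d.  The degree 0 is acceptable
    only for the two ideals whose v-number is 0: the ideal I_1 of all
    x-variables, and the maximal ideal. *)
Lemma vnumber_le I d (rho : int) : idsub I (@max_ideal K (n + m)) -> vdegree I d ->
    (d = 0%N -> ideq I (Ix K n m 1) \/ ideq I (@max_ideal K (n + m))) ->
    d%:Z <= rho ->
  exists v : nat,
    [/\ ~ ideq I (Ix K n m 1) -> is_vnumber I v,
        ideq I (Ix K n m 1) -> is_min_vdegree 0 I v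
      & v%:Z <= rho].
Proof.
move=> Imax vd d_eq0 d_rho; have rho0 := le_trans (isT : 0 <= d%:Z) d_rho.
have [I1|notI1] := classic (ideq I (Ix K n m 1)).
  exists 0%N; split=> // _; split=> //; exact: vdegree_Ix1.
have [Im|notIm] := classic (ideq I (@max_ideal K (n + m))).
  by exists 0%N; split=> // _; left.
have d_gt0 : (0 < d)%N by case: posnP d_eq0 => // -> [].
have [v vd' min_v] := min_vdegree_exists d_gt0 vd.
exists v; split=> // [_|]; first by right.
by apply: le_trans d_rho; rewrite lez_nat.
Qed.

Lemma regularity_shift I rho : is_regularity I rho ->
  exists F : free_complex K (n + m),
    [/\ is_graded_free_resolution I F, is_minimal F
      & forall i (k : 'I_(fr_rank F i)), fr_shift k <= rho + i%:Z].
Proof.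
case=> F [resF minF _ max_rho]; exists F; split=> // i k; rewrite -lerBlDr.
apply: max_rho; apply/eqP; rewrite -lt0n; apply/card_gt0P; exists k.
by rewrite inE.
Qed.

Lemma sub_max_ideal_coef0 I :
  idsub I (@max_ideal K (n + m)) -> forall f, I f -> f@_0%MM = 0.
Proof.
move=> Imax f /Imax/max_ideal_monI f0; apply/eqP; rewrite mcoeff_eq0.
by apply/negP => /f0; rewrite eqxx.
Qed.

Lemma xsupp_ysupp_gt0 (mu : 'X_{1..n + m}) :
  ((0 < xsupp mu) || (0 < ysupp mu))%N = (mu != 0%MM).
Proof.
apply/orP/idP => [|mu0].
  have small_xs := nvars_le_deg (@lshift n m) mu.
  have small_ys := nvars_le_deg (@rshift n m) mu.
  rewrite -mdeg_eq0 mdeg_xy -lt0n addn_gt0.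
  by case=> /leq_trans; [move/(_ _ small_xs)|move/(_ _ small_ys)] => ->; rewrite ?orbT.
have /existsP[k muk] : [exists k, mu k != 0%N].
  apply: contraR mu0 => /existsPn mu0; apply/eqP/mnmP => k.
  by rewrite mnm0E; apply/eqP; rewrite -[_ == _]negbK mu0.
case: (split_ordP k) muk => [i|j] -> muk; [left|right]; apply/card_gt0P.
  by exists i; rewrite inE.
by exists j; rewrite inE.
Qed.

Lemma monI_sub_max U I : ideq I (monI U) ->
  (forall mu, U mu -> ((0 < xsupp mu) || (0 < ysupp mu))%N) ->
  idsub I (@max_ideal K (n + m)).
Proof.
move=> IU U0 f /IU If; apply/max_ideal_monI => mu /If/U0.
by rewrite xsupp_ysupp_gt0.
Qed.

(** Covers every ideal of the theorem but I_q + J_t: the hypotheses on U say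
    that a monomial in I has at least q x-variables, and that with exactly q of
    them it is in I if and only if it has at least b y-variables.  The witness is
    x_1 .. x_(q-1) y_1 .. y_b. *)
Lemma vnumber_le_reg_generator U I q b rho :
    (0 < q <= n)%N -> (b <= m)%N -> ideq I (monI U) ->
    (forall mu, U mu -> (q <= xsupp mu)%N) ->
    (forall mu, U mu -> (q < xsupp mu)%N || (b <= ysupp mu)%N) ->
    (forall mu, (q <= xsupp mu)%N -> (b <= ysupp mu)%N -> U mu) ->
    is_regularity I rho ->
  exists v : nat,
    [/\ ~ ideq I (Ix K n m 1) -> is_vnumber I v,
        ideq I (Ix K n m 1) -> is_min_vdegree 0 I v
      & v%:Z <= rho].
Proof.
case: q => // q /= qn bm IU Uq Uqb qbU regI.
have Imax : idsub I (@max_ideal K (n + m)).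
  by apply: (monI_sub_max IU) => mu /Uq /(leq_ltn_trans (leq0n q)) ->.
apply: (vnumber_le (d := (q + b)%N)) => //.
- apply: (vdegree_front (c := false) (ltnW qn) bm IU) => nu; rewrite orbF.
  apply/idP/idP => [/Uq //|/qbU]; apply.
  by have [] := nvars_front nu bm (@front_r n m q b).
- case: q Uq qbU {qn Uqb} => // Uq; rewrite add0n => qbU b0; left.
  apply: (ideq_trans IU); apply: ideq_trans (ideq_sym (@Ix_monI K n m 1)).
  apply: monI_ext => mu; apply/idP/idP => [/Uq //|/qbU]; apply.
  by rewrite b0.
have [F [resF minF shiftF]] := regularity_shift regI.
have [|f If f_low|/(_ 'X_[front n m q.+1 b])|k] :=
    @generator_shift_ge _ _ I F (sub_max_ideal_coef0 Imax) resF
      (monI (fun mu => q.+1 < xsupp mu)%N) (q.+1 + b).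
- by apply: monI_ideal => mu nu /leq_trans->//; apply: nvarsD.
- move=> mu f_mu; have U_mu := (IU f).1 If mu f_mu.
  case/orP: (Uqb mu U_mu) => // b_mu; have := f_low mu f_mu.
  rewrite ltnNge mdeg_xy leq_add //.
    exact: leq_trans (Uq mu U_mu) (nvars_le_deg _ _).
  exact: leq_trans b_mu (nvars_le_deg _ _).
- have xq : xsupp (front n m q.+1 b) = q.+1 := nvars_front0 qn (@front_l n m _ _).
  have yb : ysupp (front n m q.+1 b) = b := nvars_front0 bm (@front_r n m _ _).
  move=> IP; have /IP/monI_X : I 'X_[front n m q.+1 b].
    by apply/IU/monI_X/qbU; rewrite ?xq ?yb.
  by rewrite xq ltnn.
- move/le_trans/(_ (shiftF _ _)); rewrite addSn -addn1 PoszD.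
  by rewrite lerD2r.
Qed.

(** The ideal I_q + J_t, with witness x_1 .. x_(q-1) y_1 .. y_(t-1). *)
Lemma vnumber_le_reg_sum I q t rho :
    (0 < q <= n)%N -> (0 < t <= m)%N ->
    ideq I (monI (fun mu => (q <= xsupp mu)%N || (t <= ysupp mu)%N)) ->
    is_regularity I rho ->
  exists v : nat,
    [/\ ~ ideq I (Ix K n m 1) -> is_vnumber I v,
        ideq I (Ix K n m 1) -> is_min_vdegree 0 I v
      & v%:Z <= rho].
Proof.
case: q => // q; case: t => // t /= qn tm IU regI.
have Imax : idsub I (@max_ideal K (n + m)).
  apply: (monI_sub_max IU) => mu.
  by case/orP=> /(leq_ltn_trans (leq0n _)) ->; rewrite ?orbT.
apply: (vnumber_le (d := (q + t)%N)) => //.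
- exact: (vdegree_front (c := true) (ltnW qn) (ltnW tm) IU).
- case: q t IU {qn tm} => // -[] // IU _; right.
  apply: (ideq_trans IU); apply: ideq_trans (ideq_sym (@max_ideal_monI K (n + m))).
  by apply: monI_ext => mu; rewrite xsupp_ysupp_gt0.
have [F [resF minF shiftF]] := regularity_shift regI.
have uvI f i j : I f -> (i < q.+1)%N -> (j < t.+1)%N -> (to_uv f)`_i`_j = 0.
  move=> /IU If iq jt; apply/eqP; apply: contraT => /to_uv_coef[mu [/If]].
  have small_xs := nvars_le_deg (@lshift n m) mu.
  have small_ys := nvars_le_deg (@rshift n m) mu.
  case/orP=> [q_mu ix _|t_mu _ jy].
    by move: iq; rewrite ltnNge -ix (leq_trans q_mu).
  by move: jt; rewrite ltnNge -jy (leq_trans t_mu).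
have IX : I 'X_[front n m q.+1 0].
  by apply/IU/monI_X; rewrite [xsupp _](nvars_front0 qn (@front_l n m _ _)) leqnn.
have IY : I 'X_[front n m 0 t.+1].
  apply/IU/monI_X; rewrite [ysupp _](nvars_front0 tm (@front_r n m _ _)).
  by rewrite leqnn orbT.
have uvX : to_uv ('X_[front n m q.+1 0] : S) = 'X^(q.+1).
  by rewrite to_uvX xdeg_front // ydeg_front // expr0 mulr1.
have uvY : to_uv ('X_[front n m 0 t.+1] : S) = ('X^(t.+1))%:P.
  by rewrite to_uvX xdeg_front // ydeg_front // expr0 mul1r.
have I0 := sub_max_ideal_coef0 Imax.
have [k] := syzygy_shift_ge I0 resF minF uvI isT isT IX IY uvX uvY.
move/le_trans/(_ (shiftF _ _)); rewrite addSn addnS -addn2 PoszD.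
by rewrite lerD2r.
Qed.

End VNumberBound.

Unset Implicit Arguments.
Set Strict Implicit.

Theorem theorem3p3 (K : fieldType) (n m q s t r : nat)
    (hq : (1 <= q)%N) (hqs : (q < s)%N) (hsn : (s <= n)%N)
    (ht : (1 <= t)%N) (htr : (t < r)%N) (hrm : (r <= m)%N)
    (I : {mpoly K[n + m]} -> Prop)
    (hI : ideq I (Ix K n m q)
       \/ ideq I (ideal_prod (Ix K n m q) (Jy K n m r))
       \/ ideq I (ideal_sum (Ix K n m q) (Jy K n m t))
       \/ ideq I (ideal_sum (ideal_prod (Ix K n m q) (Jy K n m r))
                            (Ix K n m s))
       \/ ideq I (ideal_sum (ideal_prod (Ix K n m q) (Jy K n m r))
                            (ideal_prod (Ix K n m s) (Jy K n m t))))
    (rho : int) (hrho : is_regularity I rho) :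
  exists v : nat,
    [/\ ~ ideq I (Ix K n m 1) -> is_vnumber I v,
        ideq I (Ix K n m 1) -> is_min_vdegree 0 I v
      & v%:Z <= rho].
Proof.
have qn : (0 < q <= n)%N by rewrite hq (leq_trans (ltnW hqs) hsn).
have tm : (0 < t <= m)%N by rewrite ht (leq_trans (ltnW htr) hrm).
case: hI => [IE|[IE|[IE|[IE|IE]]]].
- apply: (vnumber_le_reg_generator (b := 0%N) qn _
    (ideq_trans IE (Ix_monI _))) => // mu _.
  by rewrite orbT.
- apply: (vnumber_le_reg_generator qn hrm
    (ideq_trans IE (IxJy_monI _ _))) => // mu.
  + by case/andP.
  + by case/andP=> _ ->; rewrite orbT.
  + by move=> -> ->.
- apply: (vnumber_le_reg_sum qn tm _ hrho).
  exact: ideq_trans IE (monI_sum (Ix_monI _) (Jy_monI _)).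
- apply: (vnumber_le_reg_generator qn hrm (ideq_trans IE
    (monI_sum (IxJy_monI _ _) (Ix_monI _)))) => // mu /=.
  + by case/orP=> [/andP[]|] //; apply: leq_trans (ltnW hqs).
  + by case/orP=> [/andP[_ ->]|s_mu]; rewrite ?orbT // (leq_trans hqs s_mu).
  + by move=> -> ->.
- apply: (vnumber_le_reg_generator qn hrm (ideq_trans IE
    (monI_sum (IxJy_monI _ _) (IxJy_monI _ _)))) => // mu /=.
  + by case/orP=> /andP[] // /(leq_trans (ltnW hqs)).
  + by case/orP=> /andP[s_mu y_mu]; rewrite ?y_mu ?orbT // (leq_trans hqs s_mu).
  + by move=> -> ->.
Qed.
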